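(* (i) For every $m=1,2,\dots$, $$\delta(\tilde X_{R_m})=\nu_m:=\sqrt{\frac{\pi}{4m\tan(\frac{\pi}{2m})}+\frac{\pi^2}{8m^2\sin^2(\frac{\pi}{2m})}-1},$$ and hence $\delta(\tilde X_{R_1})>\delta(\tilde X_{R_2})>\delta(\tilde X_{R_3})>\cdots$. (ii) Let $m\ge4$ be even, and let $n\,(<m)$ be the odd number such that either $n=\frac m2$ or $n=\frac m2+1$. If $n=\frac m2$, then $\delta(X_{T_m})=\delta(X_{T_n})=\delta(\tilde X_{R_n})$. If $n=\frac m2+1$, then $\delta(X_{T_m})=\delta(\tilde X_{R_{m/2}})>\delta(\tilde X_{R_n})=\delta(X_{T_n})$.
   Context: $\Omega=\mathbb{R}/2\pi\mathbb{Z}$ carries the normalized Lebesgue (uniform probability) measure, with expectation $\mathbb{E}$; $\arg$ takes values in $(-\pi,\pi]$. For a random variable $X\ge0$ with $\mathbb{E}(X)>0$, the deviation rate is $\delta(X)=\sqrt{\mathbb{E}(X^2)-\mathbb{E}(X)^2}/\mathbb{E}(X)$. For a convex $n$-gon $T$ with vertices $\alpha_1,\dots,\alpha_n\in\mathbb{C}$ in counterclockwise order ($\alpha_{n+1}=\alpha_1$), $X_T(\omega)=\sum_{j=1}^n|\alpha_{j+1}-\alpha_j|\max\{\sin(\arg(\alpha_{j+1}-\alpha_j)-\omega),0\}$, the length of the orthogonal shadow of $T$ under light from direction $\omega$. $T_n$ denotes a regular $n$-gon ($n\ge 2$). A pre-edge bundle of size $m$ is a sequence $\mathcal{B}=\mathcal{B}(\beta_1,\dots,\beta_m)$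 of nonzero complex numbers with $0\le\arg(\beta_1)<\cdots<\arg(\beta_m)<\pi$; put $\tilde X_{\mathcal{B}}(\omega)=\sum_{j=1}^m\frac{|\beta_j|}{2}|\sin(\arg(\beta_j)-\omega)|$. It is regular, denoted $R_m$, if $|\beta_1|=\cdots=|\beta_m|$ and $\arg(\beta_{j+1})-\arg(\beta_j)\equiv\pi/m\pmod\pi$ for $j=1,\dots,m$ (indices modulo $m$); it is determined up to rotation and scaling, which do not affect $\delta(\tilde X_{R_m})$. In the formula for $\nu_m$ with $m=1$, $1/\tan(\pi/2)$ is read as $0$. *)

(* Defs.v *)
From HB Require Import structures.
From mathcomp Require Import all_boot all_order all_algebra.
From mathcomp Require Import complex.
From mathcomp Require Import all_classical all_reals all_analysis.

Set Implicit Arguments.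
Unset Strict Implicit.
Unset Printing Implicit Defensive.

Import Order.TTheory GRing.Theory Num.Theory.
Import numFieldNormedType.Exports.

Local Open Scope ring_scope.
Local Open Scope complex_scope.

Notation cnorm z := (ComplexField.Normc.normc z).

(* The point of modulus [r] and argument [t], i.e. r e^{it}. *)
Definition polar (R : realType) (r t : R) : R[i] := (r * cos t) +i* (r * sin t).

(* Principal argument, in ]-pi, pi]; see [arg_polar]. The value at 0 is
   irrelevant: everywhere below it is either excluded or multiplied by |0|. *)
Definition arg (R : realType) (z : R[i]) : R :=
  let: x +i* y := z in
  if 0 <= y then acos (x / cnorm z) else - acos (x / cnorm z).

Lemma cnorm_polar (R : realType) (r t : R) : 0 <= r -> cnorm (polar r t) = r.
Proof.
move=> r0; rewrite /= !exprMn -mulrDr cos2Dsin2 mulr1.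
by rewrite sqrtr_sqr ger0_norm.
Qed.

Lemma arg_polar (R : realType) (r t : R) :
  0 < r -> - pi < t <= pi -> arg (polar r t) = t.
Proof.
move=> r0 /andP[tl tu].
have E : arg (polar r t) = if 0 <= r * sin t then acos (cos t) else - acos (cos t).
  rewrite /arg /polar -/(polar r t) cnorm_polar; last exact: ltW.
  by rewrite [r * cos t]mulrC mulfK ?gt_eqF.
rewrite E pmulr_rge0 //; have [t0|t0] := leP 0 t.
  by rewrite sin_ge0_pi ?t0 // cosK // in_itv /= t0.
have st : 0 < sin (- t).
  by apply: sin_gt0_pi; rewrite oppr_gt0 t0 /= ltrNl.
rewrite sinN oppr_gt0 in st.
by rewrite leNgt st /= -cosN cosK ?opprK // in_itv /= oppr_ge0 ltW //= lerNl ltW.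
Qed.

Lemma two_pi_gt0 (R : realType) : 0 < 2 * pi :> R.
Proof. by rewrite mulr_gt0 // pi_gt0. Qed.

(* R / 2 pi Z with its normalized Lebesgue measure, through the fundamental
   domain [0, 2 pi]; the functions integrated below are 2 pi-periodic. *)
Definition angle_prob (R : realType) : probability (measurableTypeR R) R :=
  uniform_prob (two_pi_gt0 R).

(* [fine] is harmless for bounded measurable X, where both expectations are
   finite. *)
Definition deviation_rate d (T : measurableType d) (R : realType)
    (P : probability T R) (X : T -> R) : R :=
  let EX := fine 'E_P[X] in
  let EX2 := fine 'E_P[fun w => X w ^+ 2] in
  Num.sqrt (EX2 - EX ^+ 2) / EX.

Definition delta (R : realType) (X : R -> R) : R :=
  deviation_rate (angle_prob R) X.

(* Vertices are listed counterclockwise, with cyclic successor [ordS]. *)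
Definition shadow (R : realType) (n : nat) (alpha : 'I_n -> R[i]) (w : R) : R :=
  \sum_(j < n) cnorm (alpha (ordS j) - alpha j) *
    Num.max (sin (arg (alpha (ordS j) - alpha j) - w)) 0.

(* n points, in counterclockwise order, equally spaced on a circle of centre
   [c]; for n = 2 this is a segment, run through in both directions. *)
Definition regular_polygon (R : realType) (n : nat) (alpha : 'I_n -> R[i]) : Prop :=
  (2 <= n)%N /\
  exists (c : R[i]) (r t : R), 0 < r /\
    forall j : 'I_n, alpha j = c + polar r (t + 2 * pi * j%:R / n%:R).

Definition pre_edge_bundle (R : realType) (m : nat) (beta : 'I_m -> R[i]) : Prop :=
  [/\ forall j, beta j != 0,
      forall j, 0 <= arg (beta j) < pi
    & forall j k : 'I_m, (j < k)%N -> arg (beta j) < arg (beta k)].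

Definition bundle_shadow (R : realType) (m : nat) (beta : 'I_m -> R[i]) (w : R) : R :=
  \sum_(j < m) cnorm (beta j) / 2 * `|sin (arg (beta j) - w)|.

Definition regular_bundle (R : realType) (m : nat) (beta : 'I_m -> R[i]) : Prop :=
  [/\ pre_edge_bundle beta,
      forall j k, cnorm (beta j) = cnorm (beta k)
    & forall j : 'I_m, exists k : int,
        arg (beta (ordS j)) - arg (beta j) = pi / m%:R + k%:~R * pi].

Lemma regular_bundle_ex (R : realType) (m : nat) :
  exists beta : 'I_m -> R[i], regular_bundle beta.
Proof.
pose a (j : nat) : R := pi * j%:R / m%:R.
have api (j : 'I_m) : 0 <= a j < pi.
  have m0 : 0 < m%:R :> R by rewrite ltr0n (leq_ltn_trans _ (ltn_ord j)).
  rewrite /a divr_ge0 ?mulr_ge0 ?pi_ge0 //= ltr_pdivrMr //.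
  by rewrite ltr_pM2l ?pi_gt0 // ltr_nat.
have argE (j : 'I_m) : arg (polar 1 (a j)) = a j.
  have /andP[a0 api'] := api j; apply: arg_polar => //.
  by rewrite (ltW api') andbT (lt_le_trans _ a0) // oppr_lt0 pi_gt0.
exists (fun j => polar 1 (a j)); split => [|j k|j].
- split=> [j|j|j k jk]; rewrite ?argE //.
  + apply/eqP => z; have := cnorm_polar (a j) (@ler01 R).
    rewrite z ComplexField.Normc.normc0 => /eqP.
    by rewrite eq_sym oner_eq0.
  + have m0 : 0 < m%:R :> R by rewrite ltr0n (leq_ltn_trans _ (ltn_ord j)).
    by rewrite ltr_pM2r ?invr_gt0 // ltr_pM2l ?pi_gt0 // ltr_nat.
- by rewrite !cnorm_polar.
- have m0 : m%:R != 0 :> R by rewrite pnatr_eq0 -lt0n (leq_ltn_trans _ (ltn_ord j)).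
  rewrite !argE /a /=; have [jm|jm] := ltnP j.+1 m.
    exists 0; rewrite modn_small // mul0r addr0 -mulrBl -mulrBr.
    by rewrite -[j.+1]addn1 natrD [_ + 1]addrC addrK mulr1.
  have jE : j.+1 = m by apply/eqP; rewrite eqn_leq jm andbT ltn_ord.
  exists (-1); rewrite jE modnn mulr0 mul0r sub0r mulN1r.
  have e : pi * j%:R / m%:R + pi / m%:R = pi :> R.
    by rewrite -mulrDl -[X in _ + X]mulr1 -mulrDr natr1 jE mulfK.
  by rewrite -[X in _ - X]e opprD addrCA subrr addr0.
Qed.

(* For m = 1, tan (pi / 2) = 1 / 0 = 0, so the first summand is pi / 0 = 0, as
   it should be with 1 / tan (pi / 2) read as 0. *)
Definition nu (R : realType) (m : nat) : R :=
  Num.sqrt (pi / (4 * m%:R * tan (pi / (2 * m%:R)))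
            + pi ^+ 2 / (8 * m%:R ^+ 2 * sin (pi / (2 * m%:R)) ^+ 2) - 1).

(* Main.v *)
Require Import Defs.
From HB Require Import structures.
From mathcomp Require Import all_boot all_order all_algebra.
From mathcomp Require Import complex.
From mathcomp Require Import all_classical all_reals all_analysis.
From mathcomp Require Import measurable_realfun.
From mathcomp Require Import ring lra.

(** Every shadow function in the theorem is, up to a positive factor and a rotation,
the function [fan k], the sum of |sin (y + j pi / k)| over j < k, for some k.
For a regular bundle of size k this is the definition read modulo pi
([bundle_shadow_fan]). For a regular n-gon, let the signed width of an edge be its
component across the light; these widths cancel around the closed polygon, so the
shadow, which is the sum of the positive ones, is half of the sum of all their
absolute values ([sum_pos_part], [shadow_double_fan]). The edge
directions divide a full turn into n parts. When n = 2 k, opposite edges are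
parallel and the sum is twice [fan k] ([double_fan_even]); when n is odd, the
directions modulo pi are those of [fan n] ([double_fan_odd]). Hence the n-gon has
the deviation rate of the regular bundle of size n / 2 for n even, and n for n
odd.

The deviation rate of [fan m] is computed exactly ([delta_fan]). The function is
periodic of period pi / m, and on one period a telescoping sum gives
cos (y - h) / sin h with h = pi / (2 m) ([fanE]). Since pi / m divides 2 pi,
expectations are means over one period ([expectation_periodic]), so the first two
moments are integrals of cos and cos^2 over [- h, h]. This yields
nu_m^2 = spread h / 2 - 1, where spread x = x cot x + (x / sin x)^2 ([nuE]).

Finally nu_m decreases with m because [spread] increases on (0, pi / 2]
([spread_incr]), its derivative being positive by Wilker's inequality [wilker].
That inequality follows from Taylor bounds for sin and cos on (0, 2). *)

Set Implicit Arguments.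
Unset Strict Implicit.
Unset Printing Implicit Defensive.

Import Order.TTheory GRing.Theory Num.Theory.
Import numFieldNormedType.Exports.

Local Open Scope ring_scope.
Local Open Scope complex_scope.

(** * Taylor bounds and the monotonicity of the deviation rates *)

Section Calculus.
Variable R : realType.
Implicit Types (f df : R -> R) (a b x : R).

Lemma increment_derive f df a b : a < b ->
  (forall x, a <= x <= b -> is_derive x (1 : R) f (df x)) ->
  exists2 c, a < c < b & f b - f a = df c * (b - a).
Proof.
move=> ab fd; have [||c] := @MVT R f df a b ab.
- by move=> x; rewrite in_itv /= => /andP[/ltW ax /ltW xb]; apply: fd; rewrite ax.
- apply: derivable_within_continuous => x; rewrite in_itv /= => xab.
  by have [] := fd _ xab.
- by rewrite in_itv /= => cab ->; exists c.
Qed.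

(** The form in which the mean value theorem is used below: each Taylor bound for
sin and cos is the integral of the preceding one. *)
Lemma derive_ge0_ge0 f df x : 0 <= x -> f 0 = 0 ->
  (forall y, is_derive y (1 : R) f (df y)) -> (forall y, 0 <= y -> 0 <= df y) ->
  0 <= f x.
Proof.
rewrite le_eqVlt => /predU1P[<- -> //|x0] f0 fd df0.
have [c /andP[/ltW c0 _]] := @increment_derive f df 0 x x0 (fun y _ => fd y).
by rewrite f0 !subr0 => ->; rewrite mulr_ge0 ?df0 // ltW.
Qed.

Lemma le_sin_id x : 0 <= x -> sin x <= x.
Proof.
move=> x0; rewrite -subr_ge0.
apply: (@derive_ge0_ge0 (fun y => y - sin y) (fun y => 1 - cos y)) => //.
by rewrite sin0 subrr.
Qed.

Lemma cos_ge_quadratic x : 0 <= x -> 1 - x ^+ 2 / 2 <= cos x.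
Proof.
move=> x0; rewrite -subr_ge0.
apply: (@derive_ge0_ge0 (fun y => cos y - (1 - y ^+ 2 / 2))
                        (fun y => y - sin y)) => //.
- by rewrite cos0 expr0n /= mul0r subr0 subrr.
- by move=> y; apply: is_derive_eq; rewrite /GRing.scale /=; field.
- by move=> y y0; rewrite subr_ge0 le_sin_id.
Qed.

Lemma sin_ge_cubic x : 0 <= x -> x - x ^+ 3 / 6 <= sin x.
Proof.
move=> x0; rewrite -subr_ge0.
apply: (@derive_ge0_ge0 (fun y => sin y - (y - y ^+ 3 / 6))
                        (fun y => cos y - (1 - y ^+ 2 / 2))) => //.
- by rewrite sin0 expr0n /= mul0r subr0 subrr.
- by move=> y; apply: is_derive_eq; rewrite /GRing.scale /=; field.
- by move=> y y0; rewrite subr_ge0 cos_ge_quadratic.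
Qed.

Lemma cos_le_quartic x : 0 <= x -> cos x <= 1 - x ^+ 2 / 2 + x ^+ 4 / 24.
Proof.
move=> x0; rewrite -subr_ge0.
apply: (@derive_ge0_ge0 (fun y => 1 - y ^+ 2 / 2 + y ^+ 4 / 24 - cos y)
                        (fun y => sin y - (y - y ^+ 3 / 6))) => //.
- by rewrite cos0 !expr0n /= !mul0r subr0 addr0 subrr.
- by move=> y; apply: is_derive_eq; rewrite /GRing.scale /=; field.
- by move=> y y0; rewrite subr_ge0 sin_ge_cubic.
Qed.

(** Wilker's inequality (sin x / x)^2 + tan x / x > 2, multiplied by x^2 cos x so
that it still makes sense at pi / 2. With u = x^2, the bounds
sin x >= x (1 - u / 6) and cos x <= 1 - u / 2 + u^2 / 24 reduce it to a
polynomial inequality in u: the terms of degree 0 and 1 cancel, and the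
remaining factor is positive because u < 4. *)
Lemma wilker x : 0 < x <= pi / 2 ->
  2 * x ^+ 2 * cos x < cos x * sin x ^+ 2 + x * sin x.
Proof.
move=> /andP[x0 xpi].
have x2 : x < 2 := le_lt_trans xpi (@pihalf_lt2 R).
have c0 : 0 <= cos x.
  by rewrite cos_ge0_pihalf // xpi andbT (le_trans _ (ltW x0)) // oppr_le0
             divr_ge0 // pi_ge0.
have := cos_le_quartic (ltW x0); have := sin_ge_cubic (ltW x0).
set s := sin x; set c := cos x in c0 *; move=> sx cx.
pose u := x ^+ 2; pose q := 1 - u / 6.
have u0 : 0 < u by rewrite exprn_gt0.
have u4 : u < 4 by rewrite /u; nra.
have q0 : 0 < q by rewrite /q; lra.
have sq : x * q <= s by rewrite /q /u; lra.
have cq : c <= 1 - u / 2 + u ^+ 2 / 24 by rewrite /u; lra.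
have s2 : u * q ^+ 2 <= s ^+ 2.
  rewrite /u -exprMn lerXn2r // ?nnegrE ?mulr_ge0 ?ltW //.
  by rewrite (lt_le_trans _ sq) // mulr_gt0.
have e1 : c * (u * q ^+ 2) <= c * s ^+ 2 by rewrite ler_wpM2l.
have e2 : u * q <= x * s by rewrite /u expr2 -mulrA ler_wpM2l // ltW.
suff : 0 < c * (q ^+ 2 - 2) + q.
  by rewrite -(pmulr_rgt0 _ u0) -/u; nra.
have q2 : 0 <= 2 - q ^+ 2 by rewrite /q; nra.
(* the coefficient q^2 - 2 of c is negative, hence the upper bound of cos *)
have e3 : c * (2 - q ^+ 2) <= (1 - u / 2 + u ^+ 2 / 24) * (2 - q ^+ 2).
  by rewrite ler_wpM2r.
suff : 0 < q - (1 - u / 2 + u ^+ 2 / 24) * (2 - q ^+ 2) by lra.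
rewrite (_ : _ - _ = u ^+ 2 * (11 / 72 - u / 36 + u ^+ 2 / 864)).
  apply: mulr_gt0; first exact: exprn_gt0.
  by have := sqr_ge0 u; lra.
by rewrite /q; field.
Qed.

(** The function x cot x + (x / sin x)^2. At x = pi / (2 m), half of it is the
normalized second moment E(X^2) / E(X)^2 of the regular bundle of size m. *)
Definition spread x : R := x * cos x / sin x + (x / sin x) ^+ 2.

Lemma sin_gt0_quadrant x : 0 < x <= pi / 2 -> 0 < sin x.
Proof.
move=> /andP[x0 xpi]; apply: sin_gt0_pi; rewrite x0 (le_lt_trans xpi) //.
by rewrite ltr_pdivrMr // ltr_pMr ?pi_gt0 // ltr1n.
Qed.

(** The derivative of [spread] is the gap in Wilker's inequality divided by
(sin x)^3. *)
Lemma spread_incr a b : 0 < a -> a < b -> b <= pi / 2 -> spread a < spread b.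
Proof.
move=> a0 ab bpi.
pose d x := (cos x * sin x ^+ 2 + x * sin x - 2 * x ^+ 2 * cos x) / sin x ^+ 3.
have [|c /andP[ac cb] /eqP] := @increment_derive spread d a b ab.
  (* the computed derivative agrees with d x up to cos^2 + sin^2 = 1 *)
  move=> x /andP[ax xb].
  have s0 : sin x != 0.
    by rewrite gt_eqF // sin_gt0_quadrant // (lt_le_trans a0 ax) (le_trans xb bpi).
  rewrite /spread; apply: is_derive_eq.
  rewrite /d /GRing.scale /=.
  have := cos2Dsin2 x; move: (sin x) (cos x) s0 => s e s0 es.
  apply/eqP; rewrite -subr_eq0.
  rewrite (_ : _ - _ = x / s ^+ 2 * (1 - (e ^+ 2 + s ^+ 2))); last by field.
  by rewrite es subrr mulr0.
rewrite subr_eq => /eqP ->; rewrite ltrDr mulr_gt0 ?subr_gt0 //.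
have cI : 0 < c <= pi / 2 by rewrite (lt_trans a0 ac) (le_trans (ltW cb) bpi).
by rewrite divr_gt0 ?exprn_gt0 ?sin_gt0_quadrant // subr_gt0 wilker.
Qed.

(** A normalized variance is nonnegative: with m the mean of cos over [0, x],
G x is the integral of (cos t - m)^2 over [0, x], and it is a positive multiple
of [spread x - 2]. This is what makes the square roots comparable in
[nu_decr]. *)
Lemma spread_ge2 x : 0 < x <= pi / 2 -> 2 <= spread x.
Proof.
move=> xI; have s0 := sin_gt0_quadrant xI; have /andP[x0 _] := xI.
pose m := sin x / x.
pose G t := (t + sin t * cos t) / 2 - 2 * m * sin t + m ^+ 2 * t.
have : 0 <= G x.
  apply: (@derive_ge0_ge0 G (fun t => (cos t - m) ^+ 2)).
  - exact: ltW.
  - by rewrite /G sin0 !(mul0r, mulr0, addr0, subr0).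
  - move=> y; rewrite /G; apply: is_derive_eq.
    rewrite /GRing.scale /=; have := cos2Dsin2 y.
    move: (sin y) (cos y) => s e es.
    have -> : s * - s = e ^+ 2 - 1 by rewrite -es; ring.
    by field.
  - by move=> y _; rewrite sqr_ge0.
move=> G0; rewrite -subr_ge0.
have -> : spread x - 2 = G x * (2 * x / sin x ^+ 2).
  by rewrite /spread /G /m; field; rewrite !gt_eqF.
by rewrite mulr_ge0 // divr_ge0 ?sqr_ge0 // mulr_ge0 // ltW.
Qed.

Lemma half_step_bounds m : (0 < m)%N -> 0 < (pi / (2 * m%:R) : R) <= pi / 2.
Proof.
move=> m0; have m0' : 0 < m%:R :> R by rewrite ltr0n.
rewrite divr_gt0 ?pi_gt0 ?mulr_gt0 //= ler_pM2l ?pi_gt0 //.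
by rewrite lef_pV2 ?posrE ?mulr_gt0 // ler_pMr // ler1n.
Qed.

(** For m = 1 the conventions agree: tan (pi / 2) is the quotient 1 / 0 = 0 and its
inverse is 0, while cot (pi / 2) = 0 in [spread]. *)
Lemma nuE m : (0 < m)%N -> nu R m = Num.sqrt (spread (pi / (2 * m%:R)) / 2 - 1).
Proof.
move=> m0; congr (Num.sqrt (_ - 1)); rewrite /spread /tan.
set x := pi / (2 * m%:R).
have m0' : m%:R != 0 :> R by rewrite pnatr_eq0 -lt0n.
have -> : pi / (4 * m%:R * (sin x / cos x)) = x / 2 * (cos x / sin x).
  rewrite invfM invf_div; move: (cos x / sin x) => t; rewrite /x.
  by field.
have -> : pi ^+ 2 / (8 * m%:R ^+ 2 * sin x ^+ 2) = x ^+ 2 / 2 / sin x ^+ 2.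
  rewrite invfM; move: (sin x ^- 2) => t; rewrite /x.
  by field.
by field; rewrite gt_eqF // sin_gt0_quadrant // half_step_bounds.
Qed.

Lemma nu_decr m : (0 < m)%N -> nu R m.+1 < nu R m.
Proof.
move=> m0; rewrite !nuE //.
have /andP[x0 _] := half_step_bounds (ltn0Sn m).
have yI := half_step_bounds m0; have /andP[_ yp] := yI.
have xy : pi / (2 * m.+1%:R) < pi / (2 * m%:R) :> R.
  rewrite ltr_pM2l ?pi_gt0 // ltf_pV2 ?posrE ?mulr_gt0 ?ltr0n //.
  by rewrite ltr_pM2l // ltr_nat.
have lt := spread_incr x0 xy yp.
have ge : 2 <= spread (pi / (2 * m.+1%:R)).
  by apply: spread_ge2; exact: half_step_bounds.
rewrite ltr_sqrt; lra.
Qed.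
End Calculus.

(** * Integrals of periodic functions *)

Section Integral.
Local Open Scope classical_set_scope.
Variable R : realType.
Implicit Types (f F : R -> R) (a b c t T : R).

Local Notation mu := (@lebesgue_measure R).
Local Notation "'I[' f ; a , b ]" := (\int[mu]_(x in `[a, b]%classic) f x)%R
  (at level 0, f, a, b at level 200).

Lemma continuous_integrable f a b : continuous f ->
  mu.-integrable `[a, b] (EFin \o f).
Proof.
move=> cf; apply: continuous_compact_integrable; first exact: segment_compact.
exact: continuous_subspaceT.
Qed.

Lemma Rintegral_cat f a b c : continuous f -> a <= b -> b <= c ->
  I[f; a, c] = I[f; a, b] + I[f; b, c].
Proof.
move=> cf ab bc; apply/eqP; rewrite addrC -subr_eq; apply/eqP.
rewrite Rintegral_itvB ?bnd_simp //; last exact: continuous_integrable.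
apply: Rintegral_itv_obnd_cbnd.
apply: integrableS (continuous_integrable b c cf) => //.
exact: subset_itv_oc_cc.
Qed.

Lemma Rintegral_shift f t a b : a <= b -> continuous f ->
  I[f; a + t, b + t] = I[fun x => f (x + t); a, b].
Proof.
move=> ab cf.
have D : (fun x : R => x + t)^`() = cst 1.
  by apply/funext => x; rewrite derive1E derive_val addr0.
rewrite /Rintegral; congr fine.
have ct : continuous (fun x : R => x + t).
  by move=> x; apply: cvgD; [exact: cvg_id|exact: cvg_cst].
rewrite (@integration_by_substitution_increasing _ (fun x => x + t)) //.
- apply: eq_integral => x _; congr EFin.
  by rewrite !fctE D mulr1.
- by move=> x y _ _; rewrite ltrD2r.
- by rewrite D => ? _; exact: cvg_cst.
- by rewrite D; exact: is_cvg_cst.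
- by rewrite D; exact: is_cvg_cst.
- split.
  + by move=> x _; apply: ex_derive.
  + exact: cvg_at_right_filter (ct a).
  + exact: cvg_at_left_filter (ct b).
- exact: continuous_subspaceT.
Qed.

Lemma Rintegral_FTC f F a b : a < b -> continuous f ->
  (forall x, is_derive x (1 : R) F (f x)) -> I[f; a, b] = F b - F a.
Proof.
move=> ab cf dF.
have cF : continuous F.
  move=> x; apply: differentiable_continuous; apply/derivable1_diffP.
  by have [] := dF x.
rewrite /Rintegral (@continuous_FTC2 _ f F) //.
- exact: continuous_subspaceT.
- split.
  + by move=> x _; have [] := dF x.
  + exact: cvg_at_right_filter (cF a).
  + exact: cvg_at_left_filter (cF b).
- by move=> x _; rewrite derive1E; have [] := dF x.
Qed.

Lemma Rintegral_periodic_nat f T n : 0 <= T -> continuous f -> periodic f T ->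
  I[f; 0, T *+ n] = I[f; 0, T] *+ n.
Proof.
move=> T0 cf pf; elim: n => [|n IH].
  by rewrite !mulr0n set_itv1 Rintegral_set1.
rewrite (@Rintegral_cat f 0 (T *+ n)) ?mulrn_wge0 //; last by rewrite mulrS lerDr.
rewrite IH [RHS]mulrSr; congr (_ + _).
rewrite -[X in I[f; X, _]]add0r mulrS Rintegral_shift //.
by apply: eq_Rintegral => x _; rewrite (periodicn pf).
Qed.

Lemma periodicz f T (k : int) x : periodic f T -> f (x + k%:~R * T) = f x.
Proof.
move=> pf; case: k => n; first by rewrite -pmulrn mulr_natl (periodicn pf).
rewrite NegzE mulrNz mulNr -pmulrn mulr_natl.
by rewrite -[in RHS](subrK (T *+ n.+1) x) (periodicn pf).
Qed.

(** The integral of a T-periodic function over a window of length T does not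
depend on the window: a shift by a multiple of T brings the left end d of the
window into [0, T], and the part of the window beyond T, shifted back by T, is
the missing piece [0, d]. *)
Lemma Rintegral_window f T c : 0 < T -> continuous f -> periodic f T ->
  I[f; c, c + T] = I[f; 0, T].
Proof.
move=> T0 cf pf.
pose k := Num.floor (c / T); pose d := c - k%:~R * T.
have d0 : 0 <= d.
  by rewrite subr_ge0 -ler_pdivlMr // Num.Theory.floor_le.
have dT : d <= T.
  rewrite lerBlDr -{1}[T]mul1r -mulrDl -ler_pdivrMr // addrC.
  by have /ltW := floorD1_gt (c / T); rewrite intrD.
rewrite -(subrK (k%:~R * T) c) -/d; move: d d0 dT => d d0 dT.
rewrite addrAC Rintegral_shift // ?lerDl ?ltW //.
rewrite (_ : (fun x => f (x + _)) = f); last first.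
  by apply/funext => x; exact: periodicz.
rewrite (@Rintegral_cat f d T) // ?lerDr //.
rewrite -[X in I[f; X, d + T]]add0r Rintegral_shift //.
rewrite (_ : (fun x => f (x + T)) = f); last exact/funext.
by rewrite addrC -Rintegral_cat.
Qed.

Lemma expectation_angle f : continuous f -> (forall x, 0 <= f x) ->
  fine 'E_(angle_prob R)[f] = I[f; 0, 2 * pi] / (2 * pi).
Proof.
move=> cf f0; rewrite unlock /angle_prob integral_uniform.
- rewrite subr0 fineM //; first by rewrite mulrC.
  apply: integrable_fin_num => //; exact: continuous_integrable.
- by apply/measurable_EFinP; exact: continuous_measurable_fun.
- by move=> x; rewrite lee_fin.
Qed.

(** The expectation of a T-periodic function, when T divides the full turn, is
its mean over any one period; it therefore suffices to know an antiderivative of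
a function g that agrees with f on one window only. *)
Lemma expectation_periodic f g F T m c :
  0 < T -> T *+ m = 2 * pi -> continuous f -> (forall x, 0 <= f x) ->
  periodic f T -> continuous g -> (forall x, is_derive x (1 : R) F (g x)) ->
  (forall x, c <= x <= c + T -> f x = g x) ->
  fine 'E_(angle_prob R)[f] = (F (c + T) - F c) / T.
Proof.
move=> T0 Tm cf f0 pf cg dF fg.
have m0 : m%:R != 0 :> R.
  apply/eqP => m0; have := two_pi_gt0 R.
  by rewrite -Tm -mulr_natr m0 mulr0 ltxx.
rewrite expectation_angle // -Tm Rintegral_periodic_nat // ?ltW //.
rewrite -(Rintegral_window c T0 cf pf).
rewrite (_ : I[f; c, c + T] = I[g; c, c + T]); last first.
  by apply: eq_Rintegral => x; rewrite inE /= in_itv /= => /fg.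
rewrite (@Rintegral_FTC g F) ?ltrDl //.
by rewrite -[_ *+ m]mulr_natr -[T *+ m]mulr_natr; field; rewrite m0 gt_eqF.
Qed.

End Integral.

(** * The shadow of a regular bundle in closed form *)

Section Fan.
Variable R : realType.
Implicit Types (x y w theta C : R) (m n : nat).

(** The shadow, up to scaling, of m unit segments whose directions divide a half
turn equally. *)
Definition fan m y : R := \sum_(j < m) `|sin (y + pi / m%:R *+ j)|.

Lemma normr_sin_periodic : periodic (fun x : R => `|sin x|) pi.
Proof. by move=> x; rewrite /= sinDpi normrN. Qed.

Lemma step_mulrn m : (0 < m)%N -> pi / m%:R *+ m = pi :> R.
Proof. by move=> m0; rewrite -mulr_natr mulfVK // pnatr_eq0 -lt0n. Qed.

(** A shift by pi / m permutes the m lines cyclically. *)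
Lemma fan_periodic m : periodic (fan m) (pi / m%:R).
Proof.
case: m => [|m] y; first by rewrite /fan !big_ord0.
rewrite /fan; set T := pi / m.+1%:R.
rewrite big_ord_recr [RHS]big_ord_recl /= mulr0n addr0 addrC -addrA -mulrS.
rewrite step_mulrn // normr_sin_periodic; congr (_ + _).
by apply: eq_bigr => j _; rewrite -addrA -mulrS.
Qed.

Lemma fan_continuous m : continuous (fan m).
Proof.
apply: continuous_big => [|j _ y]; first exact: add_continuous.
apply: cvg_norm; apply: continuous_comp; last exact: continuous_sin.
by apply: cvgD; [exact: cvg_id|exact: cvg_cst].
Qed.

Lemma fan_ge0 m y : 0 <= fan m y.
Proof. by apply: sumr_ge0 => j _; exact: normr_ge0. Qed.

(** On one period all the sines are nonnegative, so the absolute values disappear;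
after multiplication by 2 sin h, where h = pi / (2 m) is half the step, the sum
telescopes by the product-to-sum formula. *)
Lemma fanE m y : (0 < m)%N -> 0 <= y <= pi / m%:R ->
  fan m y = cos (y - pi / (2 * m%:R)) / sin (pi / (2 * m%:R)).
Proof.
move=> m0 /andP[y0 ym]; have := half_step_bounds R m0.
move hE : (pi / (2 * m%:R)) => h hI.
have mR : m%:R != 0 :> R by rewrite pnatr_eq0 -lt0n.
have T2 : pi / m%:R = h *+ 2 :> R by rewrite -hE mulr2n; field.
have sh : sin h != 0 by rewrite gt_eqF // sin_gt0_quadrant.
have /andP[h0 _] := hI.
pose g j := cos (y - h + h *+ 2 *+ j).
apply: (@mulIf _ (2 * sin h)); first by rewrite mulf_neq0.
have -> : cos (y - h) / sin h * (2 * sin h) = 2 * cos (y - h) by field.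
rewrite /fan mulr_suml T2.
transitivity (\sum_(0 <= j < m) (g j - g j.+1)).
  rewrite big_mkord; apply: eq_bigr => j _.
  rewrite ger0_norm; last first.
    apply: sin_ge0_pi; rewrite addr_ge0 ?mulrn_wge0 // ?(ltW h0) //=.
    rewrite -[X in _ <= X](step_mulrn m0) T2.
    apply: (@le_trans _ _ (h *+ 2 *+ j.+1)).
      by rewrite [leRHS]mulrS lerD2r -T2.
    by rewrite ler_pMn2l ?ltn_ord // mulrn_wgt0.
  rewrite /g (_ : y - h + h *+ 2 *+ j = (y + h *+ 2 *+ j) - h); last by ring.
  rewrite (_ : y - h + h *+ 2 *+ j.+1 = (y + h *+ 2 *+ j) + h); last first.
    by rewrite [_ *+ j.+1]mulrS; move: (h *+ 2 *+ j) => t; ring.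
  by move: (y + _) => z; rewrite cosB cosD; ring.
rewrite (@telescope_sumr_eq _ 0 m (fun j => - g j)) //; last first.
  by move=> j _; rewrite opprK addrC.
rewrite opprK addrC /g mulr0n addr0 -T2 step_mulrn // cosDpi.
by ring.
Qed.

(** Neither the factor [C] nor the rotation [theta] affects the deviation rate.
With h = pi / (2 m), the first two moments are the means over one period of a
multiple of cos and of its square, on an interval of half-width h. *)
Lemma delta_fan m C theta (X : R -> R) : (0 < m)%N -> 0 < C ->
  (forall w, X w = C * fan m (theta - w)) -> delta X = nu R m.
Proof.
(* T, h and k are kept opaque so that the arithmetic treats them as atoms *)
move=> m0 C0 XE; have [T TE] : exists T, T = pi / m%:R :> R by exists (pi / m%:R).
have -> : X = fun w => C * fan m (theta - w) by exact/funext.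
have mR : m%:R != 0 :> R by rewrite pnatr_eq0 -lt0n.
have T0 : 0 < T by rewrite TE divr_gt0 ?pi_gt0 // ltr0n.
have := half_step_bounds R m0; move hE : (pi / (2 * m%:R)) => h hI.
have hT : T = 2 * h by rewrite TE -hE; field.
have s0 : 0 < sin h := sin_gt0_quadrant hI.
have /andP[h0 _] := hI.
have Tm : T *+ (2 * m) = 2 * pi.
  by rewrite TE mulnC mulrnA step_mulrn // mulr_natl.
pose f w := C * fan m (theta - w).
have [k kE] : exists k, k = C / sin h by exists (C / sin h).
pose g w := k * cos (theta - h - w).
have cf : continuous f.
  move=> w; apply: cvgM; first exact: cvg_cst.
  apply: (continuous_comp (f := fun w => theta - w) (g := fan m)).
    by apply: cvgB; [exact: cvg_cst|exact: cvg_id].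
  exact: fan_continuous.
have cg : continuous g.
  move=> w; apply: cvgM; first exact: cvg_cst.
  apply: (continuous_comp (f := fun w => theta - h - w) (g := cos)).
    by apply: cvgB; [exact: cvg_cst|exact: cvg_id].
  exact: continuous_cos.
have f0 w : 0 <= f w by rewrite mulr_ge0 ?fan_ge0 // ltW.
have pf : periodic f T.
  move=> w; rewrite /f; congr (_ * _).
  by rewrite -[in RHS](subrK T (theta - w)) TE fan_periodic -TE opprD addrA.
have fg w : theta - T <= w <= theta - T + T -> f w = g w.
  rewrite subrK => /andP[lw wu]; rewrite /f fanE //; last first.
    by rewrite subr_ge0 wu -TE lerBlDl -lerBlDr.
  by rewrite hE /g kE addrAC; field; rewrite gt_eqF.
have dF w : is_derive w (1 : R) (fun w => - k * sin (theta - h - w)) (g w).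
  by apply: is_derive_eq; rewrite /GRing.scale /= /g; ring.
have eu : theta - h - theta = - h by ring.
have el : theta - h - (theta - T) = h by rewrite hT; ring.
have mean : fine 'E_(angle_prob R)[f] = k * (2 * sin h) / T.
  rewrite (expectation_periodic T0 Tm cf f0 pf cg dF fg) subrK eu el sinN.
  by congr (_ / _); ring.
have dF2 w : is_derive w (1 : R)
    (fun w => k ^+ 2 / 2 * (w - sin (theta - h - w) * cos (theta - h - w)))
    (g w ^+ 2).
  apply: is_derive_eq; rewrite /GRing.scale /= /g.
  have := cos2Dsin2 (theta - h - w); move: (cos _) (sin _) => c s es.
  apply/eqP; rewrite -subr_eq0.
  rewrite (_ : _ - _ = k ^+ 2 / 2 * (1 - (c ^+ 2 + s ^+ 2))); last by field.
  by rewrite es subrr mulr0.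
have mean2 : fine 'E_(angle_prob R)[fun w => f w ^+ 2] =
    k ^+ 2 * (h + sin h * cos h) / T.
  rewrite (expectation_periodic T0 Tm (f := fun w => f w ^+ 2) _ _ _ _ dF2
             (c := theta - T)).
  - by rewrite subrK eu el sinN cosN hT; congr (_ / _); field.
  - by move=> w; apply: cvgM; exact: cf.
  - by move=> w; exact: sqr_ge0.
  - by move=> w /=; rewrite pf.
  - by move=> w; apply: cvgM; exact: cg.
  - by move=> w wI /=; rewrite fg.
(* the variance is the square of the mean times spread h / 2 - 1 *)
rewrite /delta /deviation_rate -/f mean mean2 nuE // hE.
have k0 : 0 < k by rewrite kE divr_gt0.
move EE : (k * (2 * sin h) / T) => E.
have E0 : 0 < E by rewrite -EE divr_gt0 // !mulr_gt0.
rewrite (_ : _ - _ = E ^+ 2 * (spread h / 2 - 1)).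
  by rewrite sqrtrM ?sqr_ge0 // sqrtr_sqr gtr0_norm // mulrC mulKf // gt_eqF.
by rewrite -EE hT /spread; field; rewrite !gt_eqF.
Qed.

End Fan.

(** * Shadows of regular bundles and regular polygons *)

Section Geometry.
Variable R : realType.
Implicit Types (x y w theta C : R) (m n : nat) (z : R[i]).

Lemma cnorm_ge0 z : 0 <= cnorm z.
Proof. by case: z => x y; exact: sqrtr_ge0. Qed.

(** The arguments of a regular bundle are those of an arithmetic progression of
step pi / m up to multiples of pi, to which |sin| is insensitive. *)
Lemma bundle_shadow_fan m (beta : 'I_m -> R[i]) : (0 < m)%N ->
  regular_bundle beta -> exists C theta,
    0 < C /\ forall w, bundle_shadow beta w = C * fan m (theta - w).
Proof.
case: m beta => // m beta _ [[b0 _ _] bc bS].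
exists (cnorm (beta ord0) / 2), (arg (beta ord0)); split.
  rewrite divr_gt0 // lt_neqAle cnorm_ge0 andbT eq_sym.
  by apply: contra (b0 ord0) => /eqP /ComplexField.Normc.eq0_normc ->.
have argE (j : nat) (jm : (j < m.+1)%N) : exists k : int,
    arg (beta (Ordinal jm)) = arg (beta ord0) + pi / m.+1%:R *+ j + k%:~R * pi.
  elim: j jm => [|j IH] jm.
    exists 0; rewrite mulr0n mul0r !addr0; congr (arg (beta _)); exact: val_inj.
  have [k kE] := IH (ltnW jm).
  have -> : Ordinal jm = ordS (Ordinal (ltnW jm)).
    by apply: val_inj; rewrite /= modn_small.
  have [l /eqP] := bS (Ordinal (ltnW jm)); rewrite subr_eq => /eqP ->.
  exists (l + k); rewrite kE intrD [_ *+ j.+1]mulrSr mulrDl; move: (_ *+ j) => u.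
  by ring.
move=> w; rewrite /bundle_shadow /fan mulr_sumr; apply: eq_bigr => -[j jm] _.
rewrite (bc _ ord0); congr (_ * _); have [k ->] := argE j jm.
by rewrite [_ + _ - w]addrAC (periodicz _ _ (@normr_sin_periodic R)) addrAC.
Qed.

Lemma polar_arg z :
  cnorm z * cos (arg z) = complex.Re z /\ cnorm z * sin (arg z) = complex.Im z.
Proof.
case: z => x y; have [N0|N0] := eqVneq (cnorm (x +i* y)) 0.
  have [-> ->] := ComplexField.Normc.eq0_normc N0.
  by rewrite /= !expr0n addr0 sqrtr0 !mul0r.
have N_gt0 : 0 < cnorm (x +i* y) by rewrite lt_neqAle eq_sym N0 cnorm_ge0.
have N2 : cnorm (x +i* y) ^+ 2 = x ^+ 2 + y ^+ 2.
  by rewrite /= sqr_sqrtr // addr_ge0 ?sqr_ge0.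
rewrite /arg; move: (cnorm (x +i* y)) N0 N_gt0 N2 => N N0 N_gt0 N2 /=.
have xN : 1 - (x / N) ^+ 2 = (y / N) ^+ 2.
  rewrite !expr_div_n N2 -(divff (x := N ^+ 2)) ?expf_neq0 // N2.
  by field; rewrite -N2 expf_neq0.
have xI : -1 <= x / N <= 1.
  rewrite -ler_norml -(@expr_le1 _ 2) // real_normK ?num_real //.
  by rewrite -subr_ge0 xN sqr_ge0.
have sE : sin (acos (x / N)) = `|y| / N.
  by rewrite sin_acos // xN sqrtr_sqr normrM normfV (gtr0_norm N_gt0).
case: ifP => y0.
  by rewrite acosK ?in_itv //= sE ger0_norm // ![N * _]mulrC !mulfVK.
rewrite cosN sinN acosK ?in_itv //= sE ltr0_norm ?ltNge ?y0 //.
by rewrite mulNr opprK ![N * _]mulrC !mulfVK.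
Qed.

(** The shadow of an edge is the positive part of a linear form in the edge, which
avoids any computation of arguments modulo 2 pi for polygons. *)
Lemma edge_shadow z w : cnorm z * Num.max (sin (arg z - w)) 0 =
  Num.max (complex.Im z * cos w - complex.Re z * sin w) 0.
Proof.
rewrite maxr_pMr ?cnorm_ge0 // mulr0 sinB mulrBr !mulrA.
by have [-> ->] := polar_arg z.
Qed.

(** Applied to the signed widths of the edges of a closed polygon across the light:
the lit edges account for half of the total absolute width. *)
Lemma sum_pos_part n (q : 'I_n -> R) : \sum_j q j = 0 ->
  \sum_j Num.max (q j) 0 = (\sum_j `|q j|) / 2.
Proof.
move=> q0; rewrite -[RHS](_ : (\sum_j q j + \sum_j `|q j|) / 2 = _); last first.
  by rewrite q0 add0r.
rewrite -big_split mulr_suml; apply: eq_bigr => j _.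
by rewrite maxr_absE subr0 addr0.
Qed.

(** As [fan], but with n directions that divide a full turn equally. *)
Definition double_fan n y : R := \sum_(j < n) `|sin (y + pi / n%:R *+ (2 * j))|.

(** With h = pi / n, an edge joins points of the circle whose angles differ by 2 h,
so its signed width is 2 r sin h cos (phi + h), where phi is the angle of its
first endpoint measured from the light. *)
Lemma shadow_double_fan n (alpha : 'I_n -> R[i]) : regular_polygon alpha ->
  exists C theta, 0 < C /\ forall w, shadow alpha w = C * double_fan n (theta - w).
Proof.
move=> [n2 [c [r [t [r0 alphaE]]]]].
have n0 : (0 < n)%N by exact: leq_trans n2.
have nR : n%:R != 0 :> R by rewrite pnatr_eq0 -lt0n.
have [h hE] : exists h, h = pi / n%:R :> R by exists (pi / n%:R).
have sh : 0 < sin h.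
  apply: sin_gt0_pi; rewrite hE divr_gt0 ?pi_gt0 ?ltr0n //=.
  by rewrite ltr_pdivrMr ?ltr0n // ltr_pMr ?pi_gt0 // ltr1n.
exists (r * sin h), (t + h + pi / 2); split; first by rewrite mulr_gt0.
move=> w; pose phi (j : nat) := t - w + h *+ (2 * j).
pose q (j : 'I_n) := r * sin (phi (ordS j)) - r * sin (phi j).
have vertexE j : alpha j = c + polar r (t + h *+ (2 * j)).
  rewrite alphaE; congr (_ + polar _ _); congr (_ + _).
  by rewrite hE -[_ *+ (2 * j)]mulr_natl natrM; field.
have edgeE j : complex.Im (alpha (ordS j) - alpha j) * cos w -
    complex.Re (alpha (ordS j) - alpha j) * sin w = q j.
  rewrite !vertexE /q /phi; case: c {alphaE vertexE} => a b /=.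
  move: (h *+ _) (h *+ _) => u v.
  rewrite ![t - w + _]addrAC !sinB.
  by ring.
(* at the last vertex the successor wraps around, which costs a full turn *)
have phiS (j : 'I_n) : sin (phi (ordS j)) = sin (phi j + h + h).
  have [jn|jn] := ltnP j.+1 n.
    rewrite /phi /= modn_small // mulnS mulrnDr; congr sin.
    by move: (h *+ (2 * j)) => u; ring.
  have jE : j.+1 = n by apply/eqP; rewrite eqn_leq jn andbT ltn_ord.
  have -> : phi j + h + h = t - w + pi *+ 2.
    rewrite /phi -!addrA -mulr2n -mulrnDr.
    rewrite -[X in (_ + X)%N]muln1 -mulnDr addn1 jE mulnC mulrnA hE.
    by rewrite step_mulrn // addrA.
  by rewrite /phi /= jE modnn muln0 mulr0n addr0 sinD2pi.
rewrite /shadow; under eq_bigr => j _ do rewrite edge_shadow edgeE.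
rewrite sum_pos_part; last first.
  apply/eqP; rewrite sumrB subr_eq0; apply/eqP/esym.
  exact: (reindex_inj (@ordS_inj n)).
rewrite /double_fan mulr_sumr mulr_suml; apply: eq_bigr => j _.
rewrite -[r * sin h]gtr0_norm ?mulr_gt0 // -normrM.
rewrite (_ : _ - w + _ = phi j + h + pi / 2); last by rewrite /phi hE; ring.
rewrite sinDpihalf /q phiS.
rewrite (_ : sin (phi j) = sin (phi j + h - h)); last by rewrite addrK.
rewrite [X in r * X - _]sinD sinB.
rewrite (_ : _ - _ = r * sin h * cos (phi j + h) * 2); last by ring.
by rewrite [in LHS]normrM [`|2|]gtr0_norm // mulfK.
Qed.

(** Opposite edges of a polygon with an even number of edges are parallel, so each
of the k lines occurs twice. *)
Lemma double_fan_even k y : (0 < k)%N -> double_fan (2 * k) y = 2 * fan k y.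
Proof.
move=> k0; have kR : k%:R != 0 :> R by rewrite pnatr_eq0 -lt0n.
have step (j : nat) : pi / (2 * k)%:R *+ (2 * j) = pi / k%:R *+ j :> R.
  by rewrite mulrnA natrM; congr (_ *+ j); rewrite mulr2n; field.
rewrite /double_fan; under eq_bigr => j _ do rewrite step.
rewrite mul2n -addnn big_split_ord /= mulr_natl mulr2n; congr (_ + _).
apply: eq_bigr => j _.
by rewrite mulrnDr step_mulrn // addrA addrAC normr_sin_periodic.
Qed.

(** For odd n, doubling permutes the residues modulo n, so the edges have n
distinct directions modulo a half turn, and these are equally spaced. *)
Lemma double_fan_odd n y : odd n -> double_fan n y = fan n y.
Proof.
move=> on; have n0 : (0 < n)%N by case: n on.
have ltm (j : 'I_n) : (2 * j %% n < n)%N by rewrite ltn_mod.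
rewrite /fan (reindex_inj (h := fun j => Ordinal (ltm j))); last first.
  have inj (i j : 'I_n) : (i <= j)%N -> 2 * i = 2 * j %[mod n] -> i = j.
    move=> ij /eqP; rewrite eq_sym eqn_mod_dvd ?leq_mul2l // -mulnBr.
    rewrite Gauss_dvdr ?coprimen2 // => dv; apply/val_inj/eqP.
    rewrite eqn_leq ij -subn_eq0 eqn0Ngt; apply/negP => /dvdn_leq /(_ dv).
    by rewrite leqNgt (leq_ltn_trans (leq_subr _ _) (ltn_ord j)).
  move=> i j /(congr1 val) /= ij; have [le|/ltnW le] := leqP i j; first exact: inj.
  by apply/esym/inj.
apply: eq_bigr => j _ /=.
rewrite {1}(divn_eq (2 * j) n) mulrnDr mulnC mulrnA step_mulrn //.
by rewrite addrCA addrC (periodicn (@normr_sin_periodic R)).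
Qed.

End Geometry.

(** * Deviation rates *)

Section Deviation.
Variable R : realType.

Lemma delta_regular_bundle m (beta : 'I_m -> R[i]) : (0 < m)%N ->
  regular_bundle beta -> delta (bundle_shadow beta) = nu R m.
Proof.
by move=> m0 /(bundle_shadow_fan m0) [C [theta [C0]]]; exact: delta_fan.
Qed.

Lemma delta_even_polygon k (alpha : 'I_(2 * k) -> R[i]) : (0 < k)%N ->
  regular_polygon alpha -> delta (shadow alpha) = nu R k.
Proof.
move=> k0 /shadow_double_fan [C [theta [C0 E]]].
apply: (@delta_fan _ k (C * 2) theta) => //; first by rewrite mulr_gt0.
by move=> w; rewrite E double_fan_even // mulrA.
Qed.

Lemma delta_odd_polygon n (alpha : 'I_n -> R[i]) : odd n ->
  regular_polygon alpha -> delta (shadow alpha) = nu R n.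
Proof.
move=> on /shadow_double_fan [C [theta [C0 E]]].
apply: (@delta_fan _ n C theta) => //; first by case: n on {alpha E}.
by move=> w; rewrite E double_fan_odd.
Qed.

End Deviation.

Theorem theorem4 (R : realType) :
  ((forall (m : nat) (beta : 'I_m -> R[i]), (1 <= m)%N ->
      regular_bundle beta -> delta (bundle_shadow beta) = nu R m)
   /\
   (forall (m : nat) (beta : 'I_m -> R[i]) (beta' : 'I_m.+1 -> R[i]),
      (1 <= m)%N -> regular_bundle beta -> regular_bundle beta' ->
      delta (bundle_shadow beta) > delta (bundle_shadow beta')))
  /\
  (forall m n : nat, (4 <= m)%N -> ~~ odd m -> odd n -> (n < m)%N ->
     (n = (m %/ 2)%N ->
        forall (Tm : 'I_m -> R[i]) (Tn : 'I_n -> R[i]) (Rn : 'I_n -> R[i]),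
        regular_polygon Tm -> regular_polygon Tn -> regular_bundle Rn ->
        delta (shadow Tm) = delta (shadow Tn) /\
        delta (shadow Tn) = delta (bundle_shadow Rn))
     /\
     (n = (m %/ 2 + 1)%N ->
        forall (Tm : 'I_m -> R[i]) (Tn : 'I_n -> R[i])
               (Rh : 'I_(m %/ 2) -> R[i]) (Rn : 'I_n -> R[i]),
        regular_polygon Tm -> regular_polygon Tn ->
        regular_bundle Rh -> regular_bundle Rn ->
        [/\ delta (shadow Tm) = delta (bundle_shadow Rh),
            delta (bundle_shadow Rh) > delta (bundle_shadow Rn)
          & delta (bundle_shadow Rn) = delta (shadow Tn)])).
Proof.
split; first split.
- by move=> m beta m0 rb; exact: delta_regular_bundle.
- move=> m beta beta' m0 rb rb'.
  by rewrite !delta_regular_bundle // nu_decr.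
move=> m n m4 em on nm.
have [k mE] : exists k, m = (2 * k)%N.
  by exists m./2; rewrite mul2n even_halfK.
have k1 : (1 < k)%N by rewrite -(ltn_pmul2l (isT : 0 < 2)%N) -mE ltnW.
subst m; rewrite mulKn //; split.
- move=> nk Tm Tn Rn pm pn rn.
  have n0 : (0 < n)%N by rewrite nk ltnW.
  rewrite (delta_even_polygon (ltnW k1) pm) (delta_odd_polygon on pn).
  by rewrite (delta_regular_bundle n0 rn) nk.
- move=> nk Tm Tn Rh Rn pm pn rh rn.
  have n0 : (0 < n)%N by rewrite nk addn1.
  rewrite (delta_even_polygon (ltnW k1) pm) (delta_odd_polygon on pn).
  rewrite (delta_regular_bundle n0 rn) (delta_regular_bundle (ltnW k1) rh).
  by split => //; rewrite nk addn1 nu_decr // ltnW.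
Qed.
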